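(* Let $n\ge 2$. For every unitarily invariant norm $\|\cdot\|$ on $\mathbb{M}_n$ and every $Z\in\mathbb{M}_n$, $$\bigl\||Z|_{\mathrm{sym}}\bigr\|\ \le\ \bigl\||Z|_{\mathrm{qsym}}\bigr\|\ \le\ \sqrt2\,\bigl\||Z|_{\mathrm{sym}}\bigr\|.$$ Moreover, both constants $1$ and $\sqrt2$ are sharp: if $c$ is a real number such that $c\,\||Z|_{\mathrm{sym}}\|\le \||Z|_{\mathrm{qsym}}\|$ for every unitarily invariant norm on $\mathbb{M}_n$ and every $Z\in\mathbb{M}_n$, then $c\le 1$; and if $C$ is a real number such that $\||Z|_{\mathrm{qsym}}\|\le C\,\||Z|_{\mathrm{sym}}\|$ for every unitarily invariant norm on $\mathbb{M}_n$ and every $Z\in\mathbb{M}_n$, then $C\ge \sqrt2$.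
   Context: $\mathbb{M}_n$ is the set of $n\times n$ complex matrices, $Z^*$ is the conjugate transpose of $Z$, and $|Z|:=(Z^*Z)^{1/2}$. The arithmetic symmetric modulus is $|Z|_{\mathrm{sym}}:=\frac{|Z|+|Z^*|}{2}$ and the quadratic symmetric modulus is $|Z|_{\mathrm{qsym}}:=\left(\frac{|Z|^2+|Z^*|^2}{2}\right)^{1/2}$. A norm $\|\cdot\|$ on $\mathbb{M}_n$ is unitarily invariant if $\|UZV\|=\|Z\|$ for all $Z\in\mathbb{M}_n$ and all unitaries $U,V\in\mathbb{M}_n$. *)

(* Defs.v *)
From mathcomp Require Import all_boot all_order all_algebra.
From mathcomp Require Import reals.
From mathcomp Require Export complex.

Set Implicit Arguments.
Unset Strict Implicit.
Unset Printing Implicit Defensive.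

Import Order.TTheory GRing.Theory Num.Theory.
Local Open Scope ring_scope.
Local Open Scope complex_scope.
Local Open Scope sesquilinear_scope.

Section PsdSqrt.
Variables (C : numClosedFieldType) (n : nat).
Implicit Types A B : 'M[C]_n.

Definition psdmx A : Prop :=
  A \is hermsymmx /\ forall v : 'rV[C]_n, 0 <= (v *m A *m v ^t*) 0 0.

(* Functional calculus on the unitary diagonalization of [A].  Only meaningful
   when [A] is positive semidefinite; [sqrtmxP] and [sqrtmx_unique] show that
   it is then the unique positive semidefinite square root of [A]. *)
Definition sqrtmx A : 'M[C]_n :=
  invmx (spectralmx A) *m diag_mx (map_mx sqrtC (spectral_diag A))
    *m spectralmx A.

Definition absmx A : 'M[C]_n := sqrtmx (A ^t* *m A).

Definition symmx A : 'M[C]_n := 2^-1 *: (absmx A + absmx (A ^t*)).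

Definition qsymmx A : 'M[C]_n :=
  sqrtmx (2^-1 *: (absmx A *m absmx A + absmx (A ^t*) *m absmx (A ^t*))).

Lemma hermsymmxP A : reflect (A ^t* = A) (A \is hermsymmx).
Proof.
rewrite qualifE /= expr0 scale1r eq_sym.
exact: eqP.
Qed.

Lemma psd_spectralE A : psdmx A ->
  A = (spectralmx A) ^t* *m diag_mx (spectral_diag A) *m spectralmx A.
Proof.
case=> hA _; have /orthomx_spectralP {1}-> := hermitian_normalmx hA.
by rewrite invmx_unitary ?spectral_unitarymx.
Qed.

Lemma psd_spectral_ge0 A i : psdmx A -> 0 <= spectral_diag A 0 i.
Proof.
move=> hA; have := hA.2 (row i (spectralmx A)).
rewrite {2}(psd_spectralE hA) rowE !trmx_mul !map_mxM !mulmxA.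
have UU : spectralmx A *m (spectralmx A) ^t* = 1%:M.
  by apply/unitarymxP/spectral_unitarymx.
rewrite -(mulmxA _ (spectralmx A) (spectralmx A ^t*)) UU mulmx1.
rewrite -(mulmxA _ (spectralmx A) (spectralmx A ^t*)) UU mulmx1.
by rewrite trmx_delta map_delta_mx -rowE -colE !mxE eqxx mulr1n.
Qed.

Lemma unitary_diag_psd (U : 'M[C]_n) (d : 'rV[C]_n) :
  U \is unitarymx -> (forall i, 0 <= d 0 i) ->
  psdmx (U ^t* *m diag_mx d *m U).
Proof.
move=> _ d0; split.
  apply/hermsymmxP; rewrite !trmx_mul !map_mxM /= trmxCK mulmxA.
  rewrite tr_diag_mx map_diag_mx; congr (_ *m diag_mx _ *m _).
  by apply/rowP=> i; rewrite mxE; apply/conj_Creal/ger0_real.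
move=> v; set w := v *m U ^t*.
have -> : v *m (U ^t* *m diag_mx d *m U) *m v ^t* = w *m diag_mx d *m w ^t*.
  by rewrite /w !trmx_mul !map_mxM /= trmxCK !mulmxA.
rewrite mul_mx_diag mxE sumr_ge0// => i _; rewrite !mxE mulrAC.
by rewrite mulr_ge0// mul_conjC_ge0.
Qed.

Lemma sqrtmxP A : psdmx A -> psdmx (sqrtmx A) /\ sqrtmx A *m sqrtmx A = A.
Proof.
move=> hA; have U := spectral_unitarymx A; split.
  rewrite /sqrtmx invmx_unitary//; apply: unitary_diag_psd => // i.
  by rewrite mxE sqrtC_ge0 psd_spectral_ge0.
rewrite {3}(psd_spectralE hA) /sqrtmx invmx_unitary// !mulmxA.
rewrite -(mulmxA _ (spectralmx A) (spectralmx A ^t*)) (unitarymxP U) mulmx1.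
rewrite -(mulmxA _ (diag_mx _) (diag_mx _)) mulmx_diag.
congr (_ *m diag_mx _ *m _).
by apply/rowP=> i; rewrite !mxE -expr2 sqrtCK.
Qed.

Lemma sqrtmx_unique A B : psdmx B -> B *m B = A -> B = sqrtmx A.
Proof.
move=> hB BA; have hA : psdmx A.
  have := hB.1; move/hermsymmxP => Bh; split.
    by apply/hermsymmxP; rewrite -BA trmx_mul map_mxM /= Bh.
  move=> v; rewrite -BA mulmxA -{2}Bh -mulmxA -map_mxM -trmx_mul mxE.
  by rewrite sumr_ge0// => i _; rewrite !mxE mul_conjC_ge0.
have UA := spectral_unitarymx A; have UB := spectral_unitarymx B.
have EB := psd_spectralE hB; have EA := psd_spectralE hA.
set U := spectralmx A in UA EA; set V := spectralmx B in UB EB.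
set a := spectral_diag A in EA; set b := spectral_diag B in EB.
have UU : U ^t* *m U = 1%:M by rewrite -invmx_unitary// mulVmx ?unitarymx_unit.
have VV : V ^t* *m V = 1%:M by rewrite -invmx_unitary// mulVmx ?unitarymx_unit.
pose W := V *m U ^t*.
have VB : V *m B = diag_mx b *m V by rewrite EB !mulmxA (unitarymxP UB) mul1mx.
have AU : A *m U ^t* = U ^t* *m diag_mx a.
  by rewrite EA -!mulmxA (unitarymxP UA) mulmx1.
have H : diag_mx b *m (diag_mx b *m W) = W *m diag_mx a.
  by rewrite /W -[RHS]mulmxA -AU -BA !mulmxA VB -(mulmxA _ V B) VB mulmxA.
have K : diag_mx b *m W = W *m diag_mx (map_mx sqrtC a).
  move: W H => W H; apply/matrixP=> i j; move/matrixP: H => /(_ i j).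
  rewrite !(mul_diag_mx, mul_mx_diag) !mxE.
  have [-> _|W0] := eqVneq (W i j) 0; first by rewrite mulr0 mul0r.
  rewrite mulrA [RHS]mulrC => /(mulIf W0); rewrite -expr2 => <-.
  by rewrite sqrCK ?psd_spectral_ge0// mulrC.
rewrite /sqrtmx invmx_unitary// -/U -/a.
rewrite {1}EB -(mulmx1 (_ *m V)) -UU.
have -> : V ^t* *m diag_mx b *m V *m (U ^t* *m U)
  = V ^t* *m (diag_mx b *m W) *m U by rewrite /W !mulmxA.
by rewrite K /W !mulmxA VV mul1mx.
Qed.

End PsdSqrt.

Section UnitarilyInvariantNorm.
Variables (R : realType) (n : nat).

Record is_norm (N : 'M[R[i]]_n -> R) : Prop := IsNorm {
  mxnorm_ge0 : forall A, 0 <= N A;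
  mxnorm_eq0 : forall A, N A = 0 -> A = 0;
  mxnormZ : forall (a : R[i]) A, N (a *: A) = Normc.normc a * N A;
  mxnormD : forall A B, N (A + B) <= N A + N B }.

Definition unitarily_invariant (N : 'M[R[i]]_n -> R) : Prop :=
  forall Z U V : 'M[R[i]]_n, U \is unitarymx -> V \is unitarymx ->
    N (U *m Z *m V) = N Z.

Record is_uinorm (N : 'M[R[i]]_n -> R) : Prop := IsUinorm {
  uinorm_norm : is_norm N;
  uinorm_invariant : unitarily_invariant N }.

End UnitarilyInvariantNorm.

(* Main.v *)
Require Import Defs.
From mathcomp Require Import all_boot all_order all_algebra.
From mathcomp Require Import fingroup perm.
From mathcomp Require Import reals complex ring lra.

(** Write A = |Z| and B = |Z*|.  Both inequalities compare, in every unitarily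
    invariant norm, the sum A + B with the square root of A^2 + B^2.

    Two facts about norms reduce the problem to scalars.  Pinching
    ([uinorm_pinching]): deleting the off-diagonal entries of a matrix does not
    increase the norm, since the result is obtained by averaging with
    conjugates by reflections.  Weak majorization
    ([uinorm_weak_majorization]): on diagonal matrices the norm grows when the
    partial sums grow, provided the smaller vector is nonincreasing and
    nonnegative; finitely many averages with transpositions and with sign
    changes go from one vector to the other.  Consequently, for positive
    semidefinite X and Y, N X <= N Y as soon as, in an orthonormal eigenbasis
    of X listed by decreasing eigenvalues, the partial sums of the eigenvalues
    of X are below those of the diagonal of Y ([uinorm_le_diag]).
    As only the diagonal of Y in that one basis matters, the argument involves
    neither the eigenvalues of Y nor Ky Fan's variational principle.

    The lower bound follows from convexity and monotonicity: the square of
    (A + B)/2 is below (A^2 + B^2)/2, the square root is operator monotone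
    ([psdmx_sqrt_mono]), hence (A + B)/2 <= |Z|_qsym as operators.

    The upper bound amounts to N S <= N (A + B) for S = (A^2 + B^2)^(1/2)
    ([uinorm_sqrt_sum]).  In an eigenbasis of S, with eigenvalues s_i, let G
    be a set of indices carrying the largest eigenvalues, t > 0 a threshold
    separating them from the others, and L the diagonal matrix with entry s_j
    for j in G and t elsewhere.  Then A <= S <= L, which gives
    A >= A L^-1 A, and in the same way B >= B L^-1 B.  Summing the diagonal
    entries over G and exchanging the two indices of the symmetric weights
    |A_ij|^2 + |B_ij|^2, whose i-th row sum is s_i^2, yields
    sum_G (A + B)_ii >= sum_G s_i ([sum_top_le_diag]).

    Both constants are attained in any unitarily invariant norm: 1 at the
    identity, and sqrt 2 at a matrix unit E_01, for which
    |Z| = E_11 and |Z*| = E_00 are orthogonal projectors. *)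

Set Implicit Arguments.
Unset Strict Implicit.
Unset Printing Implicit Defensive.

Import Order.TTheory GRing.Theory Num.Theory.
Local Open Scope ring_scope.
Local Open Scope complex_scope.
Local Open Scope sesquilinear_scope.

Local Notation Re := complex.Re.

(** * Positive semidefinite matrices *)

Section Psd.
Variable C : numClosedFieldType.

Lemma trmxC_mul m n p (A : 'M[C]_(m, n)) (B : 'M[C]_(n, p)) :
  (A *m B) ^t* = B ^t* *m A ^t*.
Proof. by rewrite trmx_mul map_mxM. Qed.

Lemma psdmx_conj m n (V : 'M[C]_(m, n)) (A : 'M[C]_n) :
  psdmx A -> psdmx (V *m A *m V ^t*).
Proof.
case=> /hermsymmxP hA pA; split.
  by apply/hermsymmxP; rewrite !trmxC_mul trmxCK hA mulmxA.
move=> v; have := pA (v *m V).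
by rewrite trmxC_mul !mulmxA.
Qed.

Lemma psdmxD n (A B : 'M[C]_n) : psdmx A -> psdmx B -> psdmx (A + B).
Proof.
case=> /hermsymmxP hA pA [/hermsymmxP hB pB]; split.
  by apply/hermsymmxP; rewrite linearD /= map_mxD hA hB.
by move=> v; rewrite mulmxDr mulmxDl mxE addr_ge0.
Qed.

Lemma psdmxZ n (a : C) (A : 'M[C]_n) : 0 <= a -> psdmx A -> psdmx (a *: A).
Proof.
move=> a0 [/hermsymmxP hA pA]; split.
  apply/hermsymmxP; rewrite linearZ /= map_mxZ /= hA.
  by congr (_ *: _); apply/conj_Creal/ger0_real.
by move=> v; rewrite -scalemxAr -scalemxAl mxE mulr_ge0.
Qed.

Lemma psdmx_herm n (A : 'M[C]_n) : psdmx A -> A ^t* = A.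
Proof. by case=> /hermsymmxP. Qed.

Lemma psdmx_diag_mx n (d : 'rV[C]_n) :
  (forall i, 0 <= d 0 i) -> psdmx (diag_mx d).
Proof.
move=> d0; have U : (1%:M : 'M[C]_n) \is unitarymx.
  by apply/unitarymxP; rewrite mul1mx trmx1 map_mx1.
by have := unitary_diag_psd U d0; rewrite trmx1 map_mx1 mul1mx mulmx1.
Qed.

Lemma psdmx_gram n (A : 'M[C]_n) : psdmx (A ^t* *m A).
Proof.
have := @psdmx_conj _ _ (A ^t*) 1%:M; rewrite trmxCK mulmx1; apply.
rewrite -[1%:M]diag_const_mx; apply: psdmx_diag_mx => i.
by rewrite mxE ler01.
Qed.

Lemma psdmx_sqr n (A : 'M[C]_n) : psdmx A -> psdmx (A *m A).
Proof. by move=> hA; have := psdmx_gram A; rewrite psdmx_herm. Qed.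

Lemma psdmx_diag_ge0 n (A : 'M[C]_n) i : psdmx A -> 0 <= A i i.
Proof.
move=> [_ /(_ (delta_mx 0 i))].
by rewrite -rowE trmx_delta map_delta_mx -colE !mxE.
Qed.

(** Operator monotonicity of the square root, by contradiction.  Suppose that
    B - A has a unit eigenvector v with eigenvalue h < 0.  Since
    B^2 - A^2 = (B - A) B + A (B - A), the quadratic form of B^2 - A^2 at v is
    h times the sum of those of A and B.  It can only be nonnegative if both
    vanish at v, and then so does that of B - A, whose value is h. *)
Lemma psdmx_sqrt_mono n (A B : 'M[C]_n) :
  psdmx A -> psdmx B -> psdmx (B *m B - A *m A) -> psdmx (B - A).
Proof.
move=> pA pB [_ pBA].
have hH : B - A \is hermsymmx.
  by apply/hermsymmxP; rewrite linearB /= map_mxB !psdmx_herm.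
have U := spectral_unitarymx (B - A).
have /orthomx_spectralP := hermitian_normalmx hH.
set V := spectralmx _ in U *; set h := spectral_diag _.
rewrite invmx_unitary // => E; rewrite E; apply: unitary_diag_psd => // i.
have hr : h 0 i \is Num.real.
  by move/mxOverP: (hermitian_spectral_diag_real hH); apply.
rewrite real_leNgt ?real0 //; apply/negP => hi.
set v := row i V.
have vv : v *m v ^t* = 1%:M.
  apply/matrixP=> a b; have /unitarymxP/matrixP/(_ i i) := U.
  rewrite !mxE eqxx !ord1 eqxx => <-; apply: eq_bigr => k _.
  by rewrite !mxE.
have vH : v *m (B - A) = h 0 i *: v.
  rewrite E !mulmxA /v rowE -(mulmxA _ V) (unitarymxP U) mulmx1 scalemxAl.
  congr (_ *m _); rewrite mul_mx_diag; apply/rowP => k; rewrite !mxE mulrC /=.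
  by case: (k =P i) => [->|_]; rewrite ?mulr0.
have Hv : (B - A) *m v ^t* = h 0 i *: v ^t*.
  have := congr1 (fun M => M ^t*) vH; rewrite /= trmxC_mul.
  move: (hH) => /hermsymmxP ->; rewrite linearZ /= map_mxZ /= => ->.
  by congr (_ *: _); apply/conj_Creal.
have := pBA v.
have -> : B *m B - A *m A = (B - A) *m B + A *m (B - A).
  by rewrite mulmxBl mulmxBr addrA subrK.
rewrite mulmxDr mulmxDl mulmxA vH -!mulmxA Hv -!scalemxAl -!scalemxAr -scalerDr.
rewrite mxE nmulr_rge0 // mxE => le0.
have a0 := pA.2 v; have b0 := pB.2 v.
have := vH => /(congr1 (fun M => (M *m v ^t*) 0 0)).
rewrite mulmxBr mulmxBl -scalemxAl vv.
rewrite mulmxA mulmxA in le0.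
rewrite mxE [X in _ + X]mxE [in RHS]mxE [X in _ * X]mxE eqxx mulr1 => Eh.
have : (v *m B *m v ^t*) 0 0 + (v *m A *m v ^t*) 0 0 == 0.
  by rewrite eq_le le0 addr_ge0.
rewrite paddr_eq0 // => /andP[/eqP b00 /eqP a00].
by move: hi; rewrite -Eh b00 a00 subr0 ltxx.
Qed.

(** From A <= L = diag(l) follows A L^-1 A <= A, of which this is the i-th
    diagonal entry.  With K the inverse of L, the difference A - A K A is
    (1 - A K) A (1 - K A) + A K (L - A) K A, a sum of two matrices congruent
    to positive semidefinite ones. *)
Lemma psdmx_weighted_row n (A : 'M[C]_n) (l : 'rV[C]_n) i :
  psdmx A -> (forall j, 0 < l 0 j) -> psdmx (diag_mx l - A) ->
  \sum_j A i j * A j i / l 0 j <= A i i.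
Proof.
move=> pA l0 pL; pose K := diag_mx (map_mx (@GRing.inv C) l).
have KK : K ^t* = K.
  by apply/psdmx_herm/psdmx_diag_mx => j; rewrite mxE invr_ge0 ltW.
have KL : K *m diag_mx l *m K = K.
  rewrite !mulmx_diag; congr diag_mx; apply/rowP => j; rewrite !mxE.
  by rewrite mulVf ?mul1r // gt_eqF.
have hA := psdmx_herm pA.
have E : A - A *m K *m A = (1%:M - A *m K) *m A *m (1%:M - A *m K) ^t*
   + (A *m K) *m (diag_mx l - A) *m (A *m K) ^t*.
  rewrite linearB /= map_mxB /= trmxC_mul trmx1 map_mx1 KK hA.
  rewrite !(mulmxBl, mulmxBr) !mul1mx !mulmx1 !mulmxA.
  rewrite -(mulmxA A K (diag_mx l)) -(mulmxA A (_ *m _) K) KL.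
  set X := A *m K *m A; set Y := X *m K *m A.
  by rewrite subrK.
have : psdmx (A - A *m K *m A) by rewrite E; apply: psdmxD; exact: psdmx_conj.
move/(psdmx_diag_ge0 i); rewrite 2!mxE subr_ge0; apply: le_trans.
rewrite mxE le_eqVlt; apply/orP; left; apply/eqP.
by apply: eq_bigr => j _; rewrite mul_mx_diag !mxE mulrAC.
Qed.

(** The trace inequality behind the upper bound.  The weights
    w i j = |A_ij|^2 + |B_ij|^2 are symmetric with row sums s_i^2, so the
    right-hand side is at least the sum over i in G and all j of w i j / l_j,
    whereas the left-hand side is the sum of w j i / l_i over the same pairs.
    The part with j in G is common to both, and elsewhere l_j = t <= l_i. *)
Lemma sum_top_le_diag n (A B : 'M[C]_n) (s : 'rV[C]_n) (G : {set 'I_n}) t :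
  psdmx A -> psdmx B -> (forall i, 0 <= s 0 i) ->
  A *m A + B *m B = diag_mx s *m diag_mx s ->
  0 < t -> (forall i, i \in G -> t <= s 0 i) ->
  (forall i, i \notin G -> s 0 i <= t) ->
  \sum_(i in G) s 0 i <= \sum_(i in G) (A i i + B i i).
Proof.
move=> pA pB s0 E t0 sG sNG.
pose l : 'rV[C]_n := \row_j if j \in G then s 0 j else t.
have l0 j : 0 < l 0 j.
  by rewrite mxE; case: ifPn => // jG; apply: lt_le_trans (sG _ jG).
have pS := psdmx_diag_mx s0.
have pLS : psdmx (diag_mx l - diag_mx s).
  rewrite -raddfB; apply: psdmx_diag_mx => j; rewrite !mxE subr_ge0.
  by case: ifPn => // /sNG.
have pL X Y : psdmx X -> psdmx Y -> X *m X + Y *m Y = diag_mx s *m diag_mx s ->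
   psdmx (diag_mx l - X).
  move=> pX pY XY; rewrite -(subrK (diag_mx s) (diag_mx l)) -addrA.
  apply: psdmxD => //; apply: psdmx_sqrt_mono => //.
  by rewrite -XY addrC addKr; apply: psdmx_sqr.
have pLA := pL _ _ pA pB E.
have pLB : psdmx (diag_mx l - B) by apply: pL pB pA _; rewrite addrC.
pose w i j := A i j * A j i + B i j * B j i.
have w0 i j : 0 <= w i j.
  rewrite /w -{2}(psdmx_herm pA) -{2}(psdmx_herm pB) !mxE.
  by rewrite addr_ge0 // mul_conjC_ge0.
have wC i j : w i j = w j i by rewrite /w mulrC [X in _ + X]mulrC.
have ws i : \sum_j w i j = s 0 i * s 0 i.
  have /matrixP/(_ i i) := E; rewrite mulmx_diag !mxE eqxx mulr1n => <-.
  by rewrite big_split.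
have lb i : \sum_j w i j / l 0 j <= A i i + B i i.
  under eq_bigr do rewrite mulrDl.
  by rewrite big_split lerD // psdmx_weighted_row.
apply: le_trans (ler_sum _ (fun i _ => lb i)).
have -> : \sum_(i in G) s 0 i = \sum_(i in G) \sum_j w j i / l 0 i.
  apply: eq_bigr => i iG; rewrite -mulr_suml (eq_bigr (w i)) // ws mxE iG.
  by rewrite mulfK // gt_eqF // (lt_le_trans t0) ?sG.
pose inG (f : 'I_n -> C) := \sum_(i in G) f i.
have split f : \sum_i f i = inG f + \sum_(i | i \notin G) f i.
  by rewrite (bigID [in G]).
rewrite -subr_ge0.
under eq_bigr do rewrite split.
under [X in _ - X]eq_bigr do rewrite split.
(* Exchanging i and j in the part where both lie in G makes it cancel. *)
rewrite !big_split /= {1}/inG exchange_big /= opprD addrACA.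
rewrite /inG /= subrr add0r -sumrB sumr_ge0 // => i iG.
rewrite -sumrB sumr_ge0 // => j jG.
rewrite (wC j) -mulrBr mulr_ge0 // subr_ge0 lef_pV2 ?posrE //.
by rewrite !mxE iG (negPf jG) sG.
Qed.

End Psd.

(** * Unitarily invariant norms and weak majorization *)

Lemma sort_ord_desc (R : realDomainType) n (x : 'I_n -> R) :
  exists p : 'S_n, forall i j : 'I_n, (i <= j)%N -> x (p j) <= x (p i).
Proof.
pose t := [tuple x i | i < n].
have tP : perm_eq (sort_tuple >=%R t) t by rewrite perm_sort.
have [p E] := tuple_permP tP; exists p => i j ij.
have sE k : x (p k) = nth 0 (sort >=%R t) k.
  have -> : sort >=%R t = [tuple tnth t (p k) | k < n] by rewrite -E.
  by rewrite -tnth_nth !tnth_mktuple.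
rewrite !sE.
have srt : sorted >=%R (sort >=%R t).
  by apply: sort_sorted => a b; apply: le_total.
have tr : transitive (>=%R : rel R).
  by move=> a b c /= ab bc; apply: le_trans bc ab.
have sz k : (k < n)%N -> k \in [pred k | (k < size (sort >=%R t))%N].
  by rewrite inE size_sort size_tuple.
apply: (sorted_leq_nth tr _ 0 srt); rewrite ?sz //.
by move=> a /=.
Qed.

Lemma perm_unitarymx (C : numClosedFieldType) n (p : 'S_n) :
  (perm_mx p : 'M[C]_n) \is unitarymx.
Proof.
apply/unitarymxP; rewrite tr_perm_mx map_perm_mx.
by rewrite -perm_mxM mulgV perm_mx1.
Qed.

Definition flip_mx (C : numClosedFieldType) n (i : 'I_n) : 'M[C]_n :=
  diag_mx (\row_j (if j == i then -1 else 1)).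

Lemma flip_unitarymx (C : numClosedFieldType) n (i : 'I_n) :
  flip_mx C i \is unitarymx.
Proof.
apply/unitarymxP; rewrite tr_diag_mx map_diag_mx mulmx_diag -diag_const_mx.
congr diag_mx; apply/rowP => j; rewrite !mxE.
by case: ifP; rewrite ?rmorphN rmorph1 ?mulrNN mulr1.
Qed.

Lemma unitarymx1 (C : numClosedFieldType) n : (1%:M : 'M[C]_n) \is unitarymx.
Proof. by apply/unitarymxP; rewrite trmx1 map_mx1 mulmx1. Qed.

Section Norm.
Variables (R : realType) (n : nat) (N : 'M[R[i]]_n -> R) (uiN : is_uinorm N).
Implicit Types (A : 'M[R[i]]_n) (m s : 'I_n -> R).

Lemma uinormZ_real (a : R) A : 0 <= a -> N (a%:C *: A) = a * N A.
Proof.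
move=> a0; rewrite (mxnormZ (uinorm_norm uiN)); congr (_ * _).
by rewrite /= expr0n addr0 sqrtr_sqr ger0_norm.
Qed.

(** The source of every decrease of the norm below: pinching, transfers between
    entries and lowering of entries are all averages of this form. *)
Lemma uinorm_mix (t : R) A U V : 0 <= t <= 1 ->
  U \is unitarymx -> V \is unitarymx ->
  N ((1 - t)%:C *: A + t%:C *: (U *m A *m V)) <= N A.
Proof.
move=> /andP[t0 t1] hU hV; apply: le_trans (mxnormD (uinorm_norm uiN) _ _) _.
rewrite !uinormZ_real ?subr_ge0 // (uinorm_invariant uiN) //.
by rewrite -mulrDl subrK mul1r.
Qed.

(** Averaging A with its conjugate by the reflection in the k-th coordinate
    clears the off-diagonal entries of the k-th row and column; this is done
    for one index after the other. *)
Lemma uinorm_pinching A : N (diag_mx (\row_i A i i)) <= N A.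
Proof.
(* The matrix left once the rows and columns in r have been cleared. *)
pose P (r : seq 'I_n) : 'M_n :=
  \matrix_(i, j) if (i == j) || (i \notin r) && (j \notin r) then A i j else 0.
have -> : diag_mx (\row_i A i i) = P (enum 'I_n).
  apply/matrixP => i j; rewrite !mxE !mem_enum orbF.
  by case: eqP => [->|].
have P0 : N (P [::]) <= N A.
  rewrite le_eqVlt; apply/orP; left; apply/eqP; congr N; apply/matrixP => i j.
  by rewrite mxE /= orbT.
elim: (enum _) => // k r; apply: le_trans.
have -> : P (k :: r) = (1 - 2^-1)%:C *: P r
    + (2^-1)%:C *: (flip_mx _ k *m P r *m flip_mx _ k).
  have h2 : (2^-1)%:C = (2^-1 : R[i]) by rewrite fmorphV rmorph_nat.
  have -> : 1 - 2^-1 = 2^-1 :> R by field.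
  rewrite h2 mul_mx_diag mul_diag_mx; apply/matrixP => i j; rewrite !mxE !inE.
  have [<-|ij] := eqVneq i j; first by case: eqP => _ /=; field.
  case: (eqVneq i k) ij => [->|ik] ij /=.
    by rewrite eq_sym (negPf ij) /=; case: ifP => _; field.
  case: (eqVneq j k) ij => [->|jk] ij /=; last by case: ifP => _; field.
  by rewrite andbF; case: ifP => _; field.
apply: uinorm_mix; rewrite ?flip_unitarymx //; lra.
Qed.

Definition rdiag m : 'M[R[i]]_n := diag_mx (\row_i (m i)%:C).

(** Moving an amount d from a larger entry m i to a smaller entry m j is an
    average of m with its image under the transposition (i j), with weight
    d / (m i - m j). *)
Lemma uinorm_transfer m (i j : 'I_n) (d : R) : i != j -> 0 <= d <= m i - m j ->
  N (rdiag (fun l => m l + d * ((l == j)%:R - (l == i)%:R))) <= N (rdiag m).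
Proof.
move=> ij /andP[d0 dm].
have [E|ne] := eqVneq (m i) (m j).
  have -> : d = 0 by apply/eqP; rewrite eq_le d0 (le_trans dm) // E subrr.
  rewrite le_eqVlt; apply/orP; left; apply/eqP; congr (N (diag_mx _)).
  by apply/rowP => l; rewrite !mxE mul0r addr0.
have gt : 0 < m i - m j.
  by rewrite lt_def subr_eq0 ne (le_trans d0).
pose t := d / (m i - m j).
have tE : d = t * (m i - m j) by rewrite divfK ?gt_eqF.
set X := rdiag _.
have -> : X = (1 - t)%:C *: rdiag m
     + t%:C *: (tperm_mx i j *m rdiag m *m tperm_mx i j).
  rewrite /tperm_mx -xcolE -xrowE /X /rdiag; apply/matrixP => k l.
  rewrite !mxE (inj_eq perm_inj).
  have [_|_] := eqVneq k l; last by rewrite !mulr0n !mulr0 addr0.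
  rewrite !mulr1n -!rmorphM -rmorphD; congr (_%:C).
  case: tpermP => [->|->|/eqP/negPf-> /eqP/negPf->].
  - by rewrite (negPf ij) eqxx /= tE; ring.
  - by rewrite eq_sym (negPf ij) eqxx /= tE; ring.
  - by rewrite /=; ring.
apply: uinorm_mix; rewrite ?perm_unitarymx //.
by rewrite divr_ge0 ?(ltW gt) // ler_pdivrMr // mul1r.
Qed.

(** A value in [0, m i[ is an average of m i and - m i, and the sign of an entry
    is changed by a unitary factor. *)
Lemma uinorm_lower m (i : 'I_n) (a : R) : 0 <= a < m i ->
  N (rdiag (fun l => if l == i then a else m l)) <= N (rdiag m).
Proof.
move=> /andP[a0 am]; have m0 : 0 < m i by apply: le_lt_trans am.
(* The weight with (1 - t) m i - t m i = a. *)
pose t := (1 - a / m i) / 2.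
set X := rdiag _.
have -> : X = (1 - t)%:C *: rdiag m + t%:C *: (flip_mx _ i *m rdiag m *m 1%:M).
  rewrite mulmx1 mul_diag_mx; apply/matrixP => k l; rewrite !mxE.
  have [_|_] := eqVneq k l; last by rewrite !mulr0n !mulr0 addr0.
  rewrite !mulr1n; case: eqP => [->|_].
    rewrite mulN1r -rmorphN -!rmorphM -rmorphD; congr (_%:C).
    by rewrite /t; field; rewrite gt_eqF.
  by rewrite mul1r -!rmorphM -rmorphD; congr (_%:C); ring.
have a1 : 0 <= a / m i <= 1.
  by rewrite divr_ge0 ?(ltW m0) // ler_pdivrMr // mul1r ltW.
apply: uinorm_mix; rewrite ?flip_unitarymx ?unitarymx1 // /t; lra.
Qed.

(** Induction on the number of indices where m and s differ; each step makes
    one more entry of m equal to that of s.  If s <= m everywhere, some entry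
    of m is lowered to that of s.  Otherwise let j be the first index with
    m j < s j.  The partial sum up to j forces some i < j with s i < m i, and
    moving min (m i - s i) (s j - m j) from i to j settles i or j.  As
    s j <= s i, the transfer is between a larger and a smaller entry.  The
    partial sums still dominate, because s <= m before j, so that between i and
    j they exceed those of s by at least m i - s i. *)
Lemma uinorm_weak_majorization s m :
  (forall i, 0 <= s i) -> (forall i j : 'I_n, (i <= j)%N -> s j <= s i) ->
  (forall k, (k <= n)%N ->
     \sum_(i < n | (i < k)%N) s i <= \sum_(i < n | (i < k)%N) m i) ->
  N (rdiag s) <= N (rdiag m).
Proof.
move=> s0 sdec; have [b] := ubnP #|[set i | m i != s i]|.
elim: b m => // b IH m; rewrite ltnS => hb maj.
have [/forallP le_sm|] := boolP [forall i, s i <= m i].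
  have [/forallP eq_ms|] := boolP [forall i, m i == s i].
    rewrite le_eqVlt; apply/orP; left; apply/eqP; congr (N (diag_mx _)).
    by apply/rowP => i; rewrite !mxE (eqP (eq_ms i)).
  rewrite negb_forall => /existsP[i ne].
  have lt_sm : s i < m i by rewrite lt_def ne le_sm.
  have lower := @uinorm_lower m i (s i).
  apply: le_trans (lower _); last by rewrite s0.
  apply: IH => [|k _].
    apply: leq_trans hb; apply: proper_card; apply/properP; split.
      apply/subsetP => l; rewrite !inE.
      by case: (l =P i) => // ->; rewrite eqxx.
    by exists i; rewrite inE // !eqxx.
  by apply: ler_sum => l _; case: eqP => [->|].
rewrite negb_forall => /existsP[j0 ne0].
have Pj0 : s j0 > m j0 by rewrite ltNge.
have [j Pj jmin] :=
  @arg_minnP _ j0 (fun j => m j < s j) (fun j : 'I_n => nat_of_ord j) Pj0.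
have ms (l : 'I_n) : (l < j)%N -> s l <= m l.
  by rewrite (leNgt (s l)); apply: contraL => /jmin; rewrite -leqNgt.
(* Otherwise m <= s up to j, with strict inequality at j. *)
have [i /andP[ij smi]] : exists i : 'I_n, (i < j)%N && (s i < m i).
  apply/existsP; apply: contraLR (maj j.+1 (ltn_ord j)).
  rewrite negb_exists -ltNge => /forallP H.
  rewrite (bigD1 j) ?ltnS //= [ltRHS](bigD1 j) ?ltnS //=.
  rewrite ltr_leD //; apply: ler_sum => l /andP[lj ne].
  have := H l; rewrite negb_and -leNgt ltn_neqAle ne -ltnS lj //.
have sij := sdec _ _ (ltnW ij).
have neij : i != j by rewrite neq_ltn ij.
pose d := Num.min (m i - s i) (s j - m j).
have d0 : 0 <= d by rewrite le_min !subr_ge0 !ltW.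
have di : d <= m i - s i by rewrite ge_min lexx.
have dj : d <= s j - m j by rewrite ge_min lexx orbT.
apply: le_trans (@uinorm_transfer m i j d neij _); last by rewrite d0; lra.
apply: IH => [|k kn].
  apply: leq_trans hb; apply: proper_card; apply/properP; split.
    apply/subsetP => l; rewrite !inE.
    have [->|li] := eqVneq l i; first by rewrite (gt_eqF smi).
    have [->|lj] := eqVneq l j; first by rewrite (lt_eqF Pj).
    by rewrite subrr mulr0 addr0.
  have [le|/ltW le] := leP (m i - s i) (s j - m j).
    exists i; rewrite inE ?(gt_eqF smi) // negbK eqxx (negPf neij) /d min_l //.
    by apply/eqP; rewrite /=; ring.
  exists j; rewrite inE ?(lt_eqF Pj) // negbK eqxx (eq_sym j) (negPf neij).
  rewrite /d min_r //.
  by apply/eqP; rewrite /=; ring.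
have sum_at (a : 'I_n) :
    \sum_(l < n | (l < k)%N) (l == a)%:R = (a < k)%N%:R :> R.
  have [ak|ak] := boolP (a < k)%N.
    rewrite (bigD1 a) //= eqxx big1 ?addr0 // => l /andP[_ /negPf ->] //.
  by rewrite big1 // => l lk; case: eqP ak lk => // <- /negPf ->.
rewrite big_split /= -mulr_sumr sumrB !sum_at.
have [jk|kj] := ltnP j k.
  by rewrite (ltn_trans ij jk) subrr mulr0 addr0 maj.
have [ik|ki] := ltnP i k; last by rewrite subrr mulr0 addr0 maj.
rewrite sub0r mulrN1 lerBrDr -lerBrDl -sumrB (bigD1 i) //=.
apply: le_trans di _; rewrite lerDl sumr_ge0 // => l /andP[lk _].
by rewrite subr_ge0 ms // (leq_trans lk).
Qed.

End Norm.

(** * Comparison of norms through the diagonal in an eigenbasis *)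

Section Dom.
Variables (R : realType) (n : nat).
Implicit Types (A B X Y S : 'M[R[i]]_n).

Lemma psdmx_diagRe A i : psdmx A -> A i i = (Re (A i i))%:C.
Proof. by move=> /(psdmx_diag_ge0 i) h; rewrite RRe_real // ger0_real. Qed.

Lemma psdmx_sorted_diag X : psdmx X ->
  exists U : 'M[R[i]]_n, exists x : 'I_n -> R,
  [/\ U \is unitarymx, U *m X *m U ^t* = rdiag x, forall i, 0 <= x i
    & forall i j : 'I_n, (i <= j)%N -> x j <= x i].
Proof.
move=> pX; have d0 i := psd_spectral_ge0 i pX.
have XE := psd_spectralE pX; have VU := spectral_unitarymx X.
set V := spectralmx X in XE VU; set d := spectral_diag X in XE d0.
have [p dec] := sort_ord_desc (fun i => Re (d 0 i)).
exists (perm_mx p *m V), (fun i => Re (d 0 (p i))); split; [| | |exact: dec].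
- exact: mul_unitarymx (perm_unitarymx _ p) VU.
- rewrite trmxC_mul XE !mulmxA -(mulmxA _ V (V ^t*)) (unitarymxP VU) mulmx1.
  rewrite -(mulmxA _ V (V ^t*)) (unitarymxP VU) mulmx1.
  rewrite tr_perm_mx map_perm_mx -row_permE -col_permE.
  apply/matrixP => i j; rewrite !mxE (inj_eq perm_inj) RRe_real //.
  by rewrite ger0_real.
- by move=> i; have := d0 (p i); rewrite lecE => /andP[].
Qed.

Variables (N : 'M[R[i]]_n -> R) (uiN : is_uinorm N).

Lemma uinorm_conj U X : U \is unitarymx -> N (U *m X *m U ^t*) = N X.
Proof.
by move=> hU; apply: (uinorm_invariant uiN _ hU); rewrite trmxC_unitary.
Qed.

(** Norms are compared through the diagonal of Y in an ordered eigenbasis of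
    X: weak majorization bounds N X by the norm of this diagonal, and pinching
    bounds the latter by N Y. *)
Lemma uinorm_le_diag U X Y x :
  U \is unitarymx -> U *m X *m U ^t* = rdiag x ->
  (forall i, 0 <= x i) -> (forall i j : 'I_n, (i <= j)%N -> x j <= x i) ->
  psdmx Y ->
  (forall k, (k <= n)%N -> \sum_(i < n | (i < k)%N) x i <=
     \sum_(i < n | (i < k)%N) Re ((U *m Y *m U ^t*) i i)) ->
  N X <= N Y.
Proof.
move=> hU EX x0 xdec pY maj.
rewrite -[N X](uinorm_conj X hU) -[N Y](uinorm_conj Y hU) EX.
have pY' := psdmx_conj U pY.
apply: le_trans (uinorm_weak_majorization uiN x0 xdec maj) _.
have := uinorm_pinching uiN (U *m Y *m U ^t*); apply: le_trans.
rewrite le_eqVlt; apply/orP; left; apply/eqP; congr (N (diag_mx _)).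
by apply/rowP => i; rewrite mxE [RHS]mxE -psdmx_diagRe.
Qed.

Lemma uinorm_psd_mono X Y : psdmx X -> psdmx (Y - X) -> N X <= N Y.
Proof.
move=> pX pYX; have pY : psdmx Y by rewrite -(subrK X Y); apply: psdmxD.
have [U [x [hU EX x0 xdec]]] := psdmx_sorted_diag pX.
apply: (uinorm_le_diag hU EX x0 xdec pY) => k _; apply: ler_sum => i _.
have /(psdmx_diag_ge0 i) := psdmx_conj U pYX.
rewrite mulmxBr mulmxBl EX.
have pY' := psdmx_conj U pY.
have xi : rdiag x i i = (x i)%:C by rewrite !mxE eqxx.
rewrite mxE [X in _ + X]mxE xi (psdmx_diagRe i pY').
by rewrite -rmorphB ler0c subr_ge0.
Qed.

(** Majorization of the eigenvalues s of S by the diagonal of A + B.  For a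
    partial sum ending with a positive eigenvalue, that eigenvalue is the
    threshold required by [sum_top_le_diag].  If the last eigenvalue is 0 there
    is no positive threshold, but the last term adds nothing on the left and a
    nonnegative amount on the right, which allows induction on the length. *)
Lemma uinorm_sqrt_sum A B S : psdmx A -> psdmx B -> psdmx S ->
  S *m S = A *m A + B *m B -> N S <= N (A + B).
Proof.
move=> pA pB pS E.
have [U [s [hU ES s0 sdec]]] := psdmx_sorted_diag pS.
apply: (uinorm_le_diag hU ES s0 sdec (psdmxD pA pB)).
have UU : U ^t* *m U = 1%:M.
  by rewrite -(invmx_unitary hU) mulVmx // (unitarymx_unit hU).
pose A' := U *m A *m U ^t*; pose B' := U *m B *m U ^t*.
have pA' : psdmx A' := psdmx_conj U pA.
have pB' : psdmx B' := psdmx_conj U pB.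
have conjM X Y :
    U *m (X *m Y) *m U ^t* = (U *m X *m U ^t*) *m (U *m Y *m U ^t*).
  by rewrite !mulmxA -(mulmxA _ (U ^t*) U) UU mulmx1.
have E' : A' *m A' + B' *m B' = rdiag s *m rdiag s.
  by rewrite -ES -!conjM E mulmxDr mulmxDl.
have top (G : {set 'I_n}) (t : R) : 0 < t ->
    (forall i, i \in G -> t <= s i) -> (forall i, i \notin G -> s i <= t) ->
    \sum_(i in G) s i <= \sum_(i in G) Re ((A' + B') i i).
  move=> t0 sG sNG; rewrite -lecR !rmorph_sum /=.
  have := @sum_top_le_diag _ _ A' B' (\row_i (s i)%:C) G t%:C pA' pB' _ E'.
  have -> : \sum_(i in G) (\row_i (s i)%:C) 0 i = \sum_(i in G) (s i)%:C.
    by apply: eq_bigr => i _; rewrite mxE.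
  have -> : \sum_(i in G) (A' i i + B' i i) =
            \sum_(i in G) (Re ((A' + B') i i))%:C.
    apply: eq_bigr => i _.
    by rewrite -(psdmx_diagRe i (psdmxD pA' pB')) [RHS]mxE.
  apply=> [i||i /sG|i /sNG]; by rewrite ?mxE ?ltcR ?lecR ?ler0c.
have -> : U *m (A + B) *m U ^t* = A' + B' by rewrite mulmxDr mulmxDl.
elim=> [|k IH] kn; first by rewrite !big_pred0.
pose o := Ordinal kn.
have [so|] := ltP 0 (s o).
  have := top [set i : 'I_n | (i < k.+1)%N] (s o) so.
  have bigG (f : 'I_n -> R) : \sum_(i in [set i : 'I_n | (i < k.+1)%N]) f i =
      \sum_(i < n | (i < k.+1)%N) f i by apply: eq_bigl => i; rewrite inE.
  rewrite !bigG.
  by apply => i; rewrite inE -?leqNgt => ik; apply: sdec => //; apply: ltnW.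
move=> so; have s00 : s o = 0 by apply/eqP; rewrite eq_le so s0.
have recr (f : 'I_n -> R) :
    \sum_(i < n | (i < k.+1)%N) f i = f o + \sum_(i < n | (i < k)%N) f i.
  rewrite (bigD1 o) ?ltnS //=; congr (_ + _); apply: eq_bigl => i.
  by rewrite ltnS andbC -val_eqE /= -ltn_neqAle.
rewrite !recr s00; apply: lerD (IH (ltnW kn)).
by have /(psdmx_diag_ge0 o) := psdmxD pA' pB'; rewrite lecE => /andP[].
Qed.

End Dom.

(** * The Frobenius norm *)

Lemma dotmx_mxvec (C : numClosedFieldType) n (A : 'M[C]_n) :
  dotmx (mxvec A) (mxvec A) = \tr (A *m A ^t*).
Proof.
rewrite dotmxE mxE (reindex _ (curry_mxvec_bij _ _)) /= /mxtrace.
transitivity (\sum_i \sum_j A i j * (A i j)^*).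
  by rewrite pair_bigA; apply: eq_bigr => -[i j] _; rewrite !mxE !mxvecE.
by apply: eq_bigr => i _; rewrite mxE; apply: eq_bigr => j _; rewrite !mxE.
Qed.

(** The Frobenius norm is a witness, so that sharpness is not vacuous.
    Flattening a matrix to a row vector brings the triangle inequality of the
    Hermitian dot product; writing the square of the norm as the trace of A A^*
    gives unitary invariance. *)
Lemma uinorm_exists (R : realType) n :
  exists N : 'M[R[i]]_n -> R, is_uinorm N.
Proof.
(* The dot product is real but complex-valued, so the norm is characterized by
   its embedding in R[i]. *)
have [F FE] : exists F : 'M[R[i]]_n -> R,
    forall A, (F A)%:C = sqrtC (dotmx (mxvec A) (mxvec A)).
  exists (fun A => Re (sqrtC (dotmx (mxvec A) (mxvec A)))) => A.
  by rewrite RRe_real // ger0_real // sqrt_dnorm_ge0.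
exists F; split; first split.
- by move=> A; rewrite -ler0c FE sqrt_dnorm_ge0.
- move=> A A0; have := FE A; rewrite A0 => /esym/eqP.
  rewrite sqrt_dnorm_eq0 => /eqP E.
  by apply/(can_inj mxvecK); rewrite E linear0.
- move=> a A; apply: (@complexI R); rewrite rmorphM !FE linearZ /= dnormZ.
  rewrite sqrtCM ?nnegrE ?exprn_ge0 ?dnorm_ge0 //.
  by rewrite sqrCK ?normr_ge0 // -FE.
- move=> A B; rewrite -lecR.
  have -> : (F A + F B)%:C = (F A)%:C + (F B)%:C.
    exact: (rmorphD (real_complex R)).
  rewrite !FE (raddfD mxvec A B).
  exact: (triangle_lerif (@dotmx R[i] (n * n)) (mxvec A) (mxvec B)).1.
move=> Z U V hU hV; apply: (@complexI R); rewrite !FE !dotmx_mxvec.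
rewrite !trmxC_mul !mulmxA -(mulmxA _ V (V ^t*)) (unitarymxP hV) mulmx1.
rewrite mxtrace_mulC !mulmxA -(invmx_unitary hU).
by rewrite (mulVmx (unitarymx_unit hU)) mul1mx.
Qed.

(** * The symmetric moduli *)

Section Moduli.
Variables (C : numClosedFieldType) (n : nat).
Implicit Types Z P : 'M[C]_n.

Lemma scalemx_sqr (a : C) Z : (a *: Z) *m (a *: Z) = (a * a) *: (Z *m Z).
Proof. by rewrite -scalemxAl -scalemxAr scalerA. Qed.

Lemma psdmx_absmx Z : psdmx (absmx Z).
Proof. exact: (sqrtmxP (psdmx_gram Z)).1. Qed.

Lemma qsymmxP Z : psdmx (qsymmx Z) /\ qsymmx Z *m qsymmx Z =
  2^-1 *: (absmx Z *m absmx Z + absmx (Z ^t*) *m absmx (Z ^t*)).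
Proof.
apply: sqrtmxP; apply: psdmxZ; first by rewrite invr_ge0 ler0n.
by apply: psdmxD; apply/psdmx_sqr/psdmx_absmx.
Qed.

(** The gap between the mean of the squares and the square of the mean is the
    square of the Hermitian matrix (|Z| - |Z*|)/2, and the square root is
    operator monotone. *)
Lemma psdmx_symmx_le_qsymmx Z : psdmx (qsymmx Z - symmx Z).
Proof.
have [pQ QQ] := qsymmxP Z.
have pA := psdmx_absmx Z; have pB := psdmx_absmx (Z ^t*).
have pX : psdmx (symmx Z).
  by apply: psdmxZ; [rewrite invr_ge0 ler0n|apply: psdmxD].
apply: psdmx_sqrt_mono => //; rewrite QQ /symmx.
set A := absmx Z in pA *; set B := absmx _ in pB *.
have -> : 2^-1 *: (A *m A + B *m B) - 2^-1 *: (A + B) *m (2^-1 *: (A + B)) =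
    (2^-1 *: (A - B)) ^t* *m (2^-1 *: (A - B)).
  have -> : (2^-1 *: (A - B)) ^t* = 2^-1 *: (A - B).
    rewrite linearZ linearB /= map_mxZ map_mxB /= !psdmx_herm //.
    by rewrite fmorphV rmorph_nat.
  rewrite -!scalemxAl -!scalemxAr !(mulmxBl, mulmxBr, mulmxDl, mulmxDr).
  by apply/matrixP => i j; rewrite !mxE; field.
exact: psdmx_gram.
Qed.

Lemma absmx_projector Z P : psdmx P -> P *m P = P -> Z ^t* *m Z = P ->
  absmx Z = P.
Proof. by move=> pP PP E; rewrite /absmx -(sqrtmx_unique pP (A := _)) ?E. Qed.

End Moduli.

Theorem theorem1p3 (R : realType) (n : nat) (hn : (2 <= n)%N) :
  (forall N : 'M[R[i]]_n -> R, is_uinorm N -> forall Z : 'M[R[i]]_n,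
     N (symmx Z) <= N (qsymmx Z) /\
     N (qsymmx Z) <= Num.sqrt 2 * N (symmx Z)) /\
  (forall c : R,
     (forall N : 'M[R[i]]_n -> R, is_uinorm N -> forall Z : 'M[R[i]]_n,
        c * N (symmx Z) <= N (qsymmx Z)) ->
     c <= 1) /\
  (forall C : R,
     (forall N : 'M[R[i]]_n -> R, is_uinorm N -> forall Z : 'M[R[i]]_n,
        N (qsymmx Z) <= C * N (symmx Z)) ->
     Num.sqrt 2 <= C).
Proof.
have r2 : Num.sqrt 2 * Num.sqrt 2 = 2 :> R by rewrite -expr2 sqr_sqrtr // ler0n.
have r20 : 0 < Num.sqrt 2 :> R by rewrite sqrtr_gt0 ltr0n.
have half : (2^-1 : R)%:C = 2^-1 by rewrite fmorphV rmorph_nat.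
have [F uiF] := uinorm_exists R n.
have F_gt0 (P : 'M[R[i]]_n) i : P i i = 1 -> 0 < F P.
  move=> Pi; rewrite lt_def (mxnorm_ge0 (uinorm_norm uiF)) andbT.
  apply/eqP => /(mxnorm_eq0 (uinorm_norm uiF)) P0.
  by have /eqP := Pi; rewrite P0 mxE eq_sym oner_eq0.
pose i0 : 'I_n := Ordinal (ltnW hn); pose i1 : 'I_n := Ordinal hn.
split; [|split].
- move=> N uiN Z; split.
    apply: (uinorm_psd_mono uiN _ (psdmx_symmx_le_qsymmx Z)).
    apply: psdmxZ; first by rewrite invr_ge0 ler0n.
    by apply: psdmxD; apply: psdmx_absmx.
  have [pQ QQ] := qsymmxP Z.
  have ps : psdmx ((Num.sqrt 2)%:C *: qsymmx Z).
    by apply: psdmxZ pQ; rewrite ler0c ltW.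
  have := uinorm_sqrt_sum uiN (psdmx_absmx Z) (psdmx_absmx (Z ^t*)) ps.
  rewrite /symmx -half !uinormZ_real ?(ltW r20) ?invr_ge0 ?ler0n // => le.
  have -> : N (qsymmx Z) = Num.sqrt 2 * (2^-1 * (Num.sqrt 2 * N (qsymmx Z))).
    by rewrite mulrCA (mulrA (Num.sqrt 2)) r2 mulKf // pnatr_eq0.
  rewrite !ler_pM2l ?invr_gt0 ?ltr0n //; apply: le.
  rewrite scalemx_sqr -rmorphM r2 QQ scalerA.
  by rewrite rmorph_nat divff ?pnatr_eq0 // scale1r.
- move=> c /(_ F uiF 1%:M).
  have p1 : psdmx (1%:M : 'M[R[i]]_n).
    by rewrite -diag_const_mx; apply: psdmx_diag_mx => i; rewrite mxE ler01.
  have h1 : (1%:M : 'M[R[i]]_n) ^t* = 1%:M by rewrite trmx1 map_mx1.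
  have a1 : absmx (1%:M : 'M[R[i]]_n) = 1%:M.
    by apply: absmx_projector; rewrite ?h1 ?mulmx1.
  have e2 : 2^-1 *: (1%:M + 1%:M) = 1%:M :> 'M[R[i]]_n.
    by rewrite -[1%:M]scale1r -scalerDl scalerA mulVf // pnatr_eq0.
  have -> : symmx (1%:M : 'M[R[i]]_n) = 1%:M by rewrite /symmx h1 a1 e2.
  have -> : qsymmx (1%:M : 'M[R[i]]_n) = 1%:M.
    rewrite /qsymmx h1 a1 mulmx1 e2; apply/esym/sqrtmx_unique => //.
    by rewrite mulmx1.
  have F1 : 0 < F 1%:M by apply: (F_gt0 _ i0); rewrite mxE eqxx.
  by rewrite -[leRHS]mul1r ler_pM2r.
move=> C /(_ F uiF (delta_mx i0 i1)).
pose P : 'M[R[i]]_n := delta_mx i0 i0 + delta_mx i1 i1.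
have ctr (i j : 'I_n) : (delta_mx i j : 'M[R[i]]_n) ^t* = delta_mx j i.
  by rewrite trmx_delta map_delta_mx.
have dd (i j k : 'I_n) :
    delta_mx i j *m delta_mx j k = delta_mx i k :> 'M[R[i]]_n.
  by rewrite mul_delta_mx.
have pd (j : 'I_n) : psdmx (delta_mx j j : 'M[R[i]]_n).
  by have := psdmx_gram (delta_mx j j : 'M[R[i]]_n); rewrite ctr dd.
have absd (i j : 'I_n) : absmx (delta_mx i j : 'M[R[i]]_n) = delta_mx j j.
  by apply: absmx_projector (pd j) (dd j j j) _; rewrite ctr dd.
have pP : psdmx P := psdmxD (pd i0) (pd i1).
have d01 : delta_mx i0 i0 *m delta_mx i1 i1 = 0 :> 'M[R[i]]_n.
  by rewrite mul_delta_mx_0.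
have d10 : delta_mx i1 i1 *m delta_mx i0 i0 = 0 :> 'M[R[i]]_n.
  by rewrite mul_delta_mx_0.
have PP : P *m P = P.
  by rewrite mulmxDl !mulmxDr !dd d01 d10 addr0 add0r.
have -> : symmx (delta_mx i0 i1) = (2^-1 : R)%:C *: P.
  by rewrite half /symmx ctr !absd addrC.
have -> : qsymmx (delta_mx i0 i1) = ((Num.sqrt 2)^-1 : R)%:C *: P.
  rewrite /qsymmx ctr !absd !dd [_ + _]addrC -/P -half.
  apply/esym/sqrtmx_unique.
    by apply: psdmxZ => //; rewrite ler0c invr_ge0 ltW.
  by rewrite scalemx_sqr PP -rmorphM -invfM r2.
have P0 : 0 < F P by apply: (F_gt0 _ i0); rewrite !mxE eqxx addr0.
rewrite !uinormZ_real ?invr_ge0 ?ler0n ?(ltW r20) // mulrA ler_pM2r //.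
have -> : (Num.sqrt 2)^-1 = Num.sqrt 2 * 2^-1 :> R.
  by rewrite -[X in _ * X^-1]r2 invfM mulVKf // gt_eqF.
by rewrite ler_pM2r // invr_gt0 ltr0n.
Qed.
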